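(* Let $f\colon H_1\to H_2$ be a continuous map between Heyting semilattices, with left adjoint $f^*$. For each $K\in\mathcal{B}d(H_2)$, there exists a largest basic domain of $H_1$ contained in $f^{-1}[K]$, denoted $f_{\leftarrow}[K]$. Moreover, the map $f_{\leftarrow}\colon\mathcal{B}d(H_2)\to\mathcal{B}d(H_1)$, $K\mapsto f_{\leftarrow}[K]$, is a coframe homomorphism (it preserves arbitrary meets and finite joins) satisfying $f_{\leftarrow}[\mathfrak{o}b]=\mathfrak{o}(f^*(b))=\neg f^{-1}[\mathfrak{c}b]$ for every $b\in H_2$.
   Context: A Heyting semilattice is a meet-semilattice $H$ with top $1$ and a binary operation $\to$ satisfying $a\wedge b\le c\Leftrightarrow b\le a\to c$. A map between Heyting semilattices is continuous if it has a left adjoint that preserves finite meets (including the top element). For $a\in H$: $\mathfrak{o}a=\{a\to x\mid x\in H\}$ and $\mathfrak{c}a=\{x\in H\mid x\ge a\}$. An ideal of $H$ is a subset $T\subseteq H$ containing $1$, closed under binary meets, and such that $x\to t\in T$ for all $x\in H$, $t\in T$; the set $\mathcal{I}dl(H)$ of ideals, ordered by inclusion, is a complete distributive lattice with intersections as meets. All $\mathfrak{c}a,\mathfrak{o}a$ are ideals and are complements of each other. The set $\mathcal{B}d(H)$ of basic domains of $H$ is the set of all subsets of the form $\bigcap_{i\in J}(\mathfrak{c}a_i^1\vee\mathfrak{o}b_i^1\vee\dots\vee\mathfrak{c}a_i^{n_i}\vee\mathfrak{o}b_i^{n_i})$ with joins taken in $\mathcal{I}dl(H)$ (finite joins, the empty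 one being $\{1\}$). Ordered by inclusion, $\mathcal{B}d(H)$ is a coframe with intersections as meets; it contains all $\mathfrak{c}a$ and $\mathfrak{o}a$, which are complements of each other in it. $\neg$ denotes complement in $\mathcal{B}d(H)$. For continuous $f$, $f^{-1}[\mathfrak{c}b]=\mathfrak{c}(f^*(b))$. *)

(* Defs.v *)
From HB Require Import structures.
From mathcomp Require Import all_boot all_order.
From mathcomp Require Import boolp classical_sets functions cardinality.

Set Implicit Arguments.
Unset Strict Implicit.
Unset Printing Implicit Defensive.

Import Order.TTheory.
Local Open Scope classical_set_scope.
Local Open Scope order_scope.

HB.mixin Record TMeetSemilattice_isHeyting d (T : Type)
    of Order.TMeetSemilattice d T := {
  himpl : T -> T -> T;
  himplP : forall a b c : T, (a `&` b <= c) = (b <= himpl a c)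
}.

#[short(type="heytingSemilatticeType")]
HB.structure Definition HeytingSemilattice d :=
  {T of TMeetSemilattice_isHeyting d T & Order.TMeetSemilattice d T}.

Definition left_adjoint d1 d2 (H1 : porderType d1) (H2 : porderType d2)
    (g : H2 -> H1) (f : H1 -> H2) : Prop :=
  forall (b : H2) (a : H1), (g b <= a) = (b <= f a).

Definition preserves_finite_meets d1 d2 (H1 : tMeetSemilatticeType d1)
    (H2 : tMeetSemilatticeType d2) (g : H2 -> H1) : Prop :=
  g \top = \top /\ {morph g : x y / x `&` y}.

Definition hcontinuous d1 d2 (H1 : heytingSemilatticeType d1)
    (H2 : heytingSemilatticeType d2) (f : H1 -> H2) : Prop :=
  exists2 g : H2 -> H1, left_adjoint g f & preserves_finite_meets g.

Section Ideals.
Context {d : Order.disp_t} {H : heytingSemilatticeType d}.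

Definition opn (a : H) : set H := range (himpl a).

Definition cld (a : H) : set H := [set x | a <= x].

Definition is_ideal (T : set H) : Prop :=
  [/\ T \top,
      forall s t, T s -> T t -> T (s `&` t)
    & forall x t, T t -> T (himpl x t)].

(* Since meets of ideals are intersections, the join of a family of ideals is
   the least ideal containing their union. *)
Definition ideal_sup (F : set (set H)) : set H :=
  smallest is_ideal (\bigcup_(T in F) T).

(* c a1 \/ o b1 \/ ... \/ c an \/ o bn for s = [:: (a1, b1); ...; (an, bn)] *)
Definition block (s : seq (H * H)) : set H :=
  ideal_sup [set T | exists2 p, p \in s & T = cld p.1 \/ T = opn p.2].

Definition is_basic_domain (K : set H) : Prop :=
  exists (J : Type) (s : J -> seq (H * H)), K = \bigcap_(i in setT) block (s i).

End Ideals.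

Record basic_domain d (H : heytingSemilatticeType d) : Type := BasicDomain {
  bd_set :> set H;
  bd_setP : is_basic_domain bd_set
}.

Section BasicDomainFacts.
Context {d : Order.disp_t} {H : heytingSemilatticeType d}.
Implicit Types (a b x y : H).

Lemma himpl_le a x : x <= himpl a x.
Proof. by rewrite -himplP leIr. Qed.

Lemma meet_himpl a x : a `&` himpl a x <= x.
Proof. by rewrite himplP. Qed.

Lemma himplA a b x : himpl a (himpl b x) = himpl (a `&` b) x.
Proof.
apply/eqP; rewrite eq_le -!himplP; apply/andP; split.
  rewrite [a `&` b]meetC -meetA.
  by apply: le_trans (meet_himpl b x); rewrite leI2 ?meet_himpl.
by rewrite meetA [b `&` a]meetC meet_himpl.
Qed.

Lemma opnP a x : opn a x <-> himpl a x <= x.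
Proof.
split=> [[y _ <-]|ax]; first by rewrite himplA meetxx.
by exists x => //; apply/eqP; rewrite eq_le ax himpl_le.
Qed.

Lemma himplI a x y : himpl a (x `&` y) = himpl a x `&` himpl a y.
Proof.
apply/eqP; rewrite eq_le lexI -!himplP; apply/andP; split.
  by rewrite !(le_trans (meet_himpl _ _)) ?leIl ?leIr.
rewrite lexI; apply/andP; split.
  by apply: le_trans (meet_himpl a x); rewrite leI2 ?leIl.
by apply: le_trans (meet_himpl a y); rewrite leI2 ?leIr.
Qed.

Lemma cld_ideal a : is_ideal (cld a).
Proof.
split=> [|s t sa ta|x t ta] /=; first exact: lex1.
  by rewrite /cld /= lexI sa ta.
exact: le_trans ta (himpl_le _ _).
Qed.

Lemma opn_ideal a : is_ideal (opn a).
Proof.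
split=> [|s t|x t]; first by apply/opnP; rewrite lex1.
  by move=> /opnP ss /opnP tt; apply/opnP; rewrite himplI leI2.
move=> [y _ <-]; exists (himpl x y) => //.
by rewrite !himplA meetC.
Qed.

Lemma block_sub (s : seq (H * H)) (T : set H) : is_ideal T ->
  (forall p, p \in s -> cld p.1 `<=` T /\ opn p.2 `<=` T) -> block s `<=` T.
Proof.
move=> iT sT; apply: smallest_sub => // x [A [p ps [->|->]]] Ax.
  by have [+ _] := sT p ps; apply.
by have [_ +] := sT p ps; apply.
Qed.

Lemma cld_block (s : seq (H * H)) p : p \in s -> cld p.1 `<=` block s.
Proof.
move=> ps x px T [_ sT]; apply: sT.
by exists (cld p.1) => //; exists p => //; left.
Qed.

Lemma opn_block (s : seq (H * H)) p : p \in s -> opn p.2 `<=` block s.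
Proof.
move=> ps x px T [_ sT]; apply: sT.
by exists (opn p.2) => //; exists p => //; right.
Qed.

Lemma bd_eqP (K L : basic_domain H) : K = L :> set H -> K = L.
Proof.
case: K L => [K pK] [L pL] /= KL; case: _ / KL pL => pL.
by rewrite (Prop_irrelevance pK pL).
Qed.

Lemma is_basic_domainP (K : set H) :
  (forall x, (forall s, K `<=` block s -> block s x) -> K x) ->
  is_basic_domain K.
Proof.
move=> hK; exists {s : seq (H * H) | K `<=` block s}, sval.
apply/seteqP; split=> [x Kx [s Ks] _ /=|x Kx]; first exact: Ks.
by apply: hK => s Ks; apply: (Kx (exist _ s Ks)).
Qed.

Lemma opn_basic b : is_basic_domain (opn b).
Proof.
exists unit, (fun=> [:: (\top, b)]); apply/seteqP; split=> [x bx _ _|x].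
  by apply: (@opn_block _ (\top, b)) bx; rewrite inE.
move=> /(_ tt I); apply: block_sub; first exact: opn_ideal.
move=> p; rewrite inE => /eqP -> /=; split=> // y /=.
by rewrite /cld /= le1x => /eqP ->; have [] := opn_ideal b.
Qed.

(* H has no bottom in general, so c a is only obtained as the infinite
   intersection of all the c a \/ o b. *)
Lemma cld_basic a : is_basic_domain (cld a).
Proof.
exists H, (fun b => [:: (a, b)]); apply/seteqP; split=> [x ax b _|x ax].
  by apply: (@cld_block _ (a, b)) ax; rewrite inE.
pose T := [set y : H | exists2 u, a <= u & exists2 v, opn x v & y = u `&` v].
have [o1 oI oi] := opn_ideal x; have [c1 cI ci] := cld_ideal a.
have iT : is_ideal T.
  split; first by exists \top; [exact: c1|exists \top; rewrite ?meetxx].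
    move=> _ _ [u au [v xv ->]] [u' au' [v' xv' ->]].
    exists (u `&` u'); first exact: cI.
    by exists (v `&` v'); [exact: oI|rewrite meetACA].
  move=> y _ [u au [v xv ->]]; exists (himpl y u); first exact: ci.
  by exists (himpl y v); [exact: oi|rewrite himplI].
have [u au [v /opnP xv xE]] : T x.
  apply: (block_sub iT) (ax x I) => p; rewrite inE => /eqP -> /=; split=> y hy.
    by exists y => //; exists \top => //; rewrite meetx1.
  by exists \top; [exact: c1|exists y; rewrite ?meet1x].
suff xu : u = x by rewrite -xu.
have v1 : v = \top.
  apply/eqP; rewrite -le1x; apply: le_trans xv.
  by rewrite -himplP meetx1 xE leIr.
by rewrite xE v1 meetx1.
Qed.

Lemma bd_inf_basic (F : set (basic_domain H)) :
  is_basic_domain (\bigcap_(K in F) (K : set H)).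
Proof.
apply: is_basic_domainP => x hx K FK.
have [J [s Ks]] := bd_setP K.
rewrite Ks => i _; apply: hx => y /(_ K FK); rewrite Ks; exact.
Qed.

End BasicDomainFacts.

Section BasicDomainLattice.
Context {d : Order.disp_t} {H : heytingSemilatticeType d}.
Implicit Types (F : set (basic_domain H)) (K L : basic_domain H).

Definition bd_cld (a : H) : basic_domain H := BasicDomain (cld_basic a).

Definition bd_opn (b : H) : basic_domain H := BasicDomain (opn_basic b).

Definition bd_inf F : basic_domain H := BasicDomain (bd_inf_basic F).

Definition bd_sup F : basic_domain H :=
  bd_inf [set L | forall K, F K -> K `<=` L].

Definition bd_complement K L : Prop :=
  bd_inf [set K; L] = bd_sup set0 /\ bd_sup [set K; L] = bd_inf set0.

End BasicDomainLattice.

Definition largest_basic_domain_in d (H : heytingSemilatticeType d)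
    (A : set H) (L : basic_domain H) : Prop :=
  L `<=` A /\ forall M : basic_domain H, M `<=` A -> M `<=` L.

Definition coframe_hom d1 d2 (H1 : heytingSemilatticeType d1)
    (H2 : heytingSemilatticeType d2)
    (g : basic_domain H2 -> basic_domain H1) : Prop :=
  (forall F, g (bd_inf F) = bd_inf (g @` F)) /\
  (forall F, finite_set F -> g (bd_sup F) = bd_sup (g @` F)).

(* Main.v *)
Require Import Defs.
From HB Require Import structures.
From mathcomp Require Import all_boot all_order.
From mathcomp Require Import boolp classical_sets functions cardinality.

(** The largest basic domain inside [f^-1 K] turns out to be the largest ideal
    inside it, namely the set of all [x] such that [f (y -> x)] lies in [K] for
    every [y] ([ideal_interior]). Since this formula visibly commutes with
    intersections, two things remain: it produces basic domains, and it
    preserves finite joins.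

    Both rest on an explicit description of joins with blocks. For a pair
    [(a, b)] put [q x := (a /\ (b -> x)) -> x]. If [T] is an ideal, then
    [T \/ c a \/ o b] is [{x | q x \in T}]: indeed [x] is the meet of [q x],
    of [b -> x], which lies in [o b], and of an element above [a]. Composing
    these operators along a list [s] of pairs gives [residue s], and
    [T \/ block s = {x | residue s x \in T}]; in particular
    [block s = {x | residue s x = \top}] ([block_residueE]), and concatenation
    of lists is composition of residues.

    Let [g] be the left adjoint. Because [g] preserves binary meets,
    [f (g b -> x) = b -> f x] (the Frobenius identity), and with the
    description of blocks this shows that the largest ideal inside
    [f^-1 (block s)] is the block of the pairs [(g a, g b)]
    ([interior_preim_block]). Hence the largest ideal inside [f^-1 K] is an
    intersection of blocks for every basic domain [K].

    Preservation of finite joins is the coframe law in disguise. If [x] lies in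
    all blocks [g s ++ g t] with [K] inside [block s] and [L] inside [block t],
    then for a fixed [t] the element [residue (g t) x] lies in the image of
    [K]; one can thus trade the images of [K] and of [L], one at a time, for
    any block [r] that contains both ([interior_preim_join]). *)

Set Implicit Arguments.
Unset Strict Implicit.
Unset Printing Implicit Defensive.

Import Order.TTheory.
Local Open Scope classical_set_scope.
Local Open Scope order_scope.

(** * Joins of ideals with blocks *)

Section Residue.
Context {d : Order.disp_t} {H : heytingSemilatticeType d}.
Implicit Types (a b x y z : H) (s t : seq (H * H)) (T : set H).

Lemma himpl_eqT a x : himpl a x = \top <-> a <= x.
Proof.
rewrite -[a in a <= x]meetx1 himplP le1x.
by split=> [->|/eqP].
Qed.

Lemma himpl1x x : himpl \top x = x.
Proof.
by apply/eqP; rewrite eq_le himpl_le andbT -[X in X <= _]meet1x meet_himpl.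
Qed.

Lemma himplCA a b x : himpl a (himpl b x) = himpl b (himpl a x).
Proof. by rewrite !himplA meetC. Qed.

Lemma meet_himplE a x : a `&` himpl a x = a `&` x.
Proof.
by apply/eqP; rewrite eq_le lexI leIl meet_himpl leI2 // himpl_le.
Qed.

(** In the lattice of ideals, [x] belongs to the join of [T], [cld p.1] and
    [opn p.2] exactly when [pair_residue p x] belongs to [T]. *)
Definition pair_residue (p : H * H) x := himpl (p.1 `&` himpl p.2 x) x.

Definition residue s x := foldr pair_residue x s.

Lemma pair_residue_himpl p y x :
  pair_residue p (himpl y x) = himpl y (pair_residue p x).
Proof.
rewrite /pair_residue [himpl p.2 _]himplCA [LHS]himplCA [LHS]himplA
  [RHS]himplA.
by congr himpl; rewrite meetCA meet_himplE meetCA.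
Qed.

Lemma residue_himpl s y x : residue s (himpl y x) = himpl y (residue s x).
Proof. by elim: s => //= p s ->; rewrite pair_residue_himpl. Qed.

Lemma ideal_mem1 T : is_ideal T -> T \top.
Proof. by case. Qed.

Lemma pair_residue_ideal p T : is_ideal T ->
  is_ideal [set x | T (pair_residue p x)].
Proof.
case=> T1 TI Ti; split=> [|x y /= Tx Ty|y x /= Tx] /=.
- by rewrite /pair_residue (himpl_eqT _ \top).2 // lex1.
- suff -> : pair_residue p (x `&` y) =
      himpl (himpl p.2 y) (pair_residue p x)
      `&` himpl (himpl p.2 x) (pair_residue p y).
    by apply: TI; apply: Ti.
  rewrite /pair_residue !himplI !himplA; congr (himpl _ x `&` himpl _ y).
    by rewrite meetA meetC.
  by rewrite meetCA.
- by rewrite pair_residue_himpl; apply: Ti.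
Qed.

Lemma pair_residue_cld p x : p.1 <= x -> pair_residue p x = \top.
Proof. by move=> px; apply/himpl_eqT; rewrite (le_trans (leIl _ _)). Qed.

Lemma pair_residue_opn p x : opn p.2 x -> pair_residue p x = \top.
Proof. by move=> /opnP px; apply/himpl_eqT; rewrite (le_trans (leIr _ _)). Qed.

(** Here [x] is the meet of its residue [q], of [w := p.2 -> x] in [opn p.2],
    and of [(q /\ w) -> x], which lies above [p.1]. *)
Lemma pair_residue_mem p T x : is_ideal T ->
  cld p.1 `<=` T -> opn p.2 `<=` T -> T (pair_residue p x) -> T x.
Proof.
case=> _ TI _ cT oT Tq.
set q := pair_residue p x in Tq; pose w := himpl p.2 x.
have -> : x = (q `&` w) `&` himpl (q `&` w) x.
  by apply/eqP; rewrite eq_le meet_himpl andbT !lexI !himpl_le.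
apply: (TI); last first.
  apply: cT; rewrite /cld /= -himplP.
  by rewrite -meetA [w `&` _]meetC meetC meet_himpl.
by apply: TI => //; apply: oT; exists x.
Qed.

Lemma residue_ideal s T : is_ideal T -> is_ideal [set x | T (residue s x)].
Proof.
elim: s T => //= p s IH T iT.
exact: IH (pair_residue_ideal p iT).
Qed.

Lemma ideal_top : is_ideal [set \top : H].
Proof.
split=> //= [x y -> ->|x _ ->]; first by rewrite meetxx.
by apply/himpl_eqT; rewrite lex1.
Qed.

Lemma residue_eqT p s x : p \in s -> cld p.1 x \/ opn p.2 x ->
  residue s x = \top.
Proof.
elim: s => // p' s IH; rewrite inE => /orP[/eqP <-|ps] px /=; last first.
  rewrite IH //; apply: pair_residue_cld; exact: lex1.
(* The residue of [x] along the tail stays above [p.1], resp. in [opn p.2]. *)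
case: px => [px|/opnP px].
  apply: pair_residue_cld; apply: le_trans px _.
  by elim: s {IH} => //= r s IH; apply: le_trans IH (himpl_le _ _).
apply: pair_residue_opn; rewrite -[x](_ : himpl p.2 x = _).
  by rewrite residue_himpl; exists (residue s x).
by apply/eqP; rewrite eq_le px himpl_le.
Qed.

(** The minimality half of the description of joins with a block;
    [residue_ideal] and [residue_eqT] provide the other half. *)
Lemma residue_mem s T x : is_ideal T ->
  (forall p, p \in s -> cld p.1 `<=` T /\ opn p.2 `<=` T) ->
  T (residue s x) -> T x.
Proof.
move=> iT; elim: s => //= p s IH sT Tx.
have [cT oT] := sT p (mem_head _ _).
apply: IH => [r rs|]; first by apply: sT; rewrite inE rs orbT.
exact: pair_residue_mem Tx.
Qed.

Lemma block_ideal s : is_ideal (block s).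
Proof.
split=> [T [[] //]|x y sx sy T TP|y x sx T TP]; have [[_ TI Ti] _] := TP.
  by apply: TI; [apply: sx|apply: sy].
by apply: Ti; apply: sx.
Qed.

Lemma block_residueE s : block s = [set x | residue s x = \top].
Proof.
apply/seteqP; split=> [|x /= sx].
  apply: block_sub (residue_ideal s ideal_top) _ => p ps.
  by split=> x px; apply: (residue_eqT ps); [left|right].
apply: (@residue_mem s _ x (block_ideal s)) => [p ps|].
  by split; [apply: cld_block|apply: opn_block].
rewrite sx; exact: ideal_mem1 (block_ideal s).
Qed.

Lemma block_nil : block ([::] : seq (H * H)) = [set \top].
Proof. exact: block_residueE. Qed.

Lemma eq_mem_block s t : s =i t -> block s = block t.
Proof.
move=> st; rewrite /block; congr ideal_sup.
by apply/seteqP; split=> T [p ps Tp]; exists p; rewrite ?st // -st.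
Qed.

Lemma block_cat s t x : block (s ++ t) x <-> block s (residue t x).
Proof. by rewrite !block_residueE /= /residue foldr_cat. Qed.

Lemma block_catl s t : block s `<=` block (s ++ t).
Proof.
apply: block_sub (block_ideal _) _ => p ps.
by split; [apply: cld_block|apply: opn_block]; rewrite mem_cat ps.
Qed.

Lemma block_catr s t : block t `<=` block (s ++ t).
Proof.
apply: block_sub (block_ideal _) _ => p ps.
by split; [apply: cld_block|apply: opn_block]; rewrite mem_cat ps orbT.
Qed.

Lemma opn_block1 b : opn b = block [:: (\top, b)].
Proof.
apply/seteqP; split; first by apply: (@opn_block _ _ _ (\top, b)); rewrite inE.
apply: block_sub (opn_ideal b) _ => p; rewrite inE => /eqP -> /=; split=> // y.
by rewrite /cld /= le1x => /eqP ->; exact: ideal_mem1 (opn_ideal b).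
Qed.

(** * Basic domains *)

Lemma block_basic s : is_basic_domain (block s).
Proof.
exists unit, (fun=> s); apply/seteqP; split=> x sx; last exact: sx tt I.
by move=> _ _.
Qed.

Lemma bd_ideal (K : basic_domain H) : is_ideal K.
Proof.
have [J [s ->]] := bd_setP K.
split=> [i _|x y Kx Ky i _|y x Kx i _]; have [B1 BI Bi] := block_ideal (s i).
- exact: B1.
- by apply: BI; [apply: Kx|apply: Ky].
- by apply: Bi; apply: Kx.
Qed.

Lemma bd_mem_blocks (K : basic_domain H) x :
  (forall s, (K : set H) `<=` block s -> block s x) -> (K : set H) x.
Proof.
have [J [s Ks]] := bd_setP K.
move=> h; rewrite Ks => i _; apply: h => y; rewrite Ks => Ky; exact: Ky.
Qed.

Lemma bd_le_sup (F : set (basic_domain H)) K : F K -> K `<=` bd_sup F.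
Proof. by move=> FK x Kx L /(_ K FK); apply. Qed.

Lemma bd_sup_le (F : set (basic_domain H)) (L : basic_domain H) :
  (forall K, F K -> K `<=` L) -> bd_sup F `<=` L.
Proof. by move=> FL x; apply. Qed.

Lemma bd_sup0E : bd_sup (set0 : set (basic_domain H)) = [set \top] :> set H.
Proof.
apply/seteqP; split=> [|x -> L _]; last exact: ideal_mem1 (bd_ideal L).
rewrite -block_nil.
exact: (@bd_sup_le set0 (BasicDomain (block_basic [::]))).
Qed.

(** The complement is unique since its meet and join with [cld a] determine a
    basic domain [N]: an element [y] of [N] gives [(a -> y) -> y] in the meet,
    so that [a -> y <= y] if the meet is trivial; and if the join is everything,
    then each block containing [N] already contains [opn a]. *)
Lemma bd_opn_complement a : unique (bd_complement (bd_cld a)) (bd_opn a).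
Proof.
split=> [|N [NI NU]].
  split; apply: bd_eqP.
    rewrite bd_sup0E; apply/seteqP; split=> [x Fx|x -> L _]; last first.
      exact: ideal_mem1 (bd_ideal L).
    have ax : a <= x by apply: (Fx (bd_cld a)); left.
    have /opnP ox : opn a x by apply: (Fx (bd_opn a)); right.
    by apply/eqP; rewrite -le1x -((himpl_eqT a x).2 ax).
  apply/seteqP; split=> [x _ K []//|x _ L FL].
  have cL : cld a `<=` L by apply: (FL (bd_cld a)); left.
  have oL : opn a `<=` L by apply: (FL (bd_opn a)); right.
  apply: (pair_residue_mem (bd_ideal L) (p := (a, a)) cL oL).
  rewrite /pair_residue /= (himpl_eqT _ x).2 ?meet_himpl //.
  exact: ideal_mem1 (bd_ideal L).
apply: bd_eqP; apply/seteqP; split=> x.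
  move=> /opnP ax; apply: bd_mem_blocks => s Ns.
  (* [cld a] is the intersection of the blocks of [(a, b)] over all [b]. *)
  have all b : block ((a, b) :: s) x.
    have : (bd_sup [set bd_cld a; N] : set H) x by rewrite NU.
    apply: (@bd_sup_le _ (BasicDomain (block_basic ((a, b) :: s)))).
    move=> K [->|->] y Ky /=.
      by apply: (@cld_block _ _ _ (a, b)) => //; apply: mem_head.
    by apply: (@block_catr [:: (a, b)]); apply: Ns.
  (* With [b := residue s x] the premise [b -> residue s x] disappears. *)
  have := all (residue s x); rewrite !block_residueE /= /pair_residue /=.
  rewrite (himpl_eqT (residue s x) _).2 // meetx1 -residue_himpl => <-.
  by congr residue; apply/eqP; rewrite eq_le ax himpl_le.
move=> Nx; apply/opnP/himpl_eqT.
have : (bd_inf [set bd_cld a; N] : set H) (himpl (himpl a x) x).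
  move=> K [->|->]; first by rewrite /= /cld /= -himplP meetC meet_himpl.
  by have [_ _] := bd_ideal N; apply.
by rewrite NI bd_sup0E.
Qed.

(** * The largest ideal inside a preimage *)

(** The largest ideal contained in [A], as soon as [A] is closed under finite
    meets. *)
Definition ideal_interior (A : set H) : set H :=
  [set x | forall y, A (himpl y x)].

Lemma ideal_interior_sub (A : set H) : ideal_interior A `<=` A.
Proof. by move=> x /(_ \top); rewrite himpl1x. Qed.

Lemma ideal_interior_max (A : set H) T : is_ideal T -> T `<=` A ->
  T `<=` ideal_interior A.
Proof. by move=> [_ _ Ti] TA x Tx y; apply: TA; apply: Ti. Qed.

Lemma ideal_interiorP (A : set H) : A \top ->
  (forall x y, A x -> A y -> A (x `&` y)) -> is_ideal (ideal_interior A).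
Proof.
move=> A1 AI; split=> [y|x y Ax Ay z|y x Ax z].
- by rewrite (himpl_eqT _ _).2 // lex1.
- by rewrite himplI; apply: AI.
- by rewrite himplA; apply: Ax.
Qed.

End Residue.

Section Preimage.
Context {d1 d2 : Order.disp_t}.
Context {H1 : heytingSemilatticeType d1} {H2 : heytingSemilatticeType d2}.
Context {f : H1 -> H2} {g : H2 -> H1}.
Hypotheses (gf : left_adjoint g f) (g1 : g \top = \top)
  (gI : {morph g : x y / x `&` y}).

Lemma radj_le_eq (x y : H2) : (forall z, (z <= x) = (z <= y)) -> x = y.
Proof. by move=> xy; apply/eqP; rewrite eq_le -xy lexx xy lexx. Qed.

(** The Frobenius identity; this is where [g] must preserve binary meets. *)
Lemma radj_himpl b x : f (himpl (g b) x) = himpl b (f x).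
Proof. by apply: radj_le_eq => y; rewrite -gf -himplP -gI gf himplP. Qed.

Lemma radjI x y : f (x `&` y) = f x `&` f y.
Proof. by apply: radj_le_eq => z; rewrite -gf !lexI !gf. Qed.

Lemma radj_eqT x : f x = \top <-> x = \top.
Proof.
by split=> [fx|->]; apply/eqP; rewrite -le1x -?gf ?lex1 // -g1 gf fx.
Qed.

Lemma interior_preim_ideal (T : set H2) : is_ideal T ->
  is_ideal (ideal_interior (f @^-1` T)).
Proof.
move=> [T1 TI _]; apply: ideal_interiorP => [|x y /= Tx Ty] /=.
  by rewrite (radj_eqT \top).2.
by rewrite radjI; apply: TI.
Qed.

Definition gpair (p : H2 * H2) : H1 * H1 := (g p.1, g p.2).

(** Apply the hypothesis to [x' := (g b -> x) -> x], which lies in the interior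
    along with [x]: the premise [b -> f x'] of its residue is [\top], so that
    this residue is [f (pair_residue (g a, g b) x)]. *)
Lemma interior_preim_pair_residue p (T : set H2) x :
  ideal_interior (f @^-1` [set z | T (pair_residue p z)]) x ->
  ideal_interior (f @^-1` T) (pair_residue (gpair p) x).
Proof.
move=> hx y /=; rewrite -pair_residue_himpl.
move: (hx (himpl (g p.2) (himpl y x) `&` y)).
rewrite /= -himplA; set z := himpl y x; set z' := himpl _ z.
suff -> : pair_residue p (f z') = f (pair_residue (gpair p) z) by [].
rewrite /pair_residue -[himpl p.2 _]radj_himpl.
have -> : himpl (g p.2) z' = \top.
  by rewrite /z' himplCA; apply/himpl_eqT.
by rewrite (radj_eqT \top).2 // meetx1 -radj_himpl /z' himplA.
Qed.

Lemma interior_preim_residue s (T : set H2) x :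
  ideal_interior (f @^-1` [set z | T (residue s z)]) x ->
  ideal_interior (f @^-1` T) (residue (map gpair s) x).
Proof.
elim: s T => //= p s IH T hx.
by apply: interior_preim_pair_residue; apply: IH.
Qed.

(** The pullback of a block along [f] is computed on generators; together with
    monotonicity of the interior this makes the interior of [f^-1 K] an
    intersection of blocks. *)
Lemma interior_preim_block s :
  ideal_interior (f @^-1` block s) = block (map gpair s).
Proof.
apply/seteqP; split=> [x|].
  rewrite (block_residueE s).
  move=> /(@interior_preim_residue s [set \top]) /ideal_interior_sub /radj_eqT.
  by rewrite block_residueE.
have iB := block_ideal s.
apply: block_sub (interior_preim_ideal iB) _ => _ /mapP[p ps ->].
split; apply: ideal_interior_max.
- exact: cld_ideal.
- by move=> x; rewrite /cld /= gf => px; apply: (cld_block ps).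
- exact: opn_ideal.
- move=> _ [x _ <-] /=; rewrite radj_himpl; apply: (opn_block ps).
  by exists (f x).
Qed.

Lemma interior_preim_basic (K : basic_domain H2) :
  is_basic_domain (ideal_interior (f @^-1` K)).
Proof.
apply: is_basic_domainP => x hx y; apply: bd_mem_blocks => s Ks.
suff : ideal_interior (f @^-1` block s) x by apply.
rewrite interior_preim_block; apply: hx; rewrite -interior_preim_block.
by move=> z Kz w; apply: Ks; apply: Kz.
Qed.

Definition bd_preim (K : basic_domain H2) : basic_domain H1 :=
  BasicDomain (interior_preim_basic K).

Lemma bd_preim_largest (K : basic_domain H2) :
  largest_basic_domain_in (f @^-1` K) (bd_preim K).
Proof.
split=> [|M]; first exact: ideal_interior_sub.
exact: ideal_interior_max (bd_ideal M).
Qed.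

Lemma bd_preim_mono (K L : basic_domain H2) :
  K `<=` L -> bd_preim K `<=` bd_preim L.
Proof. by move=> KL x Kx y; apply: KL; apply: Kx. Qed.

Lemma bd_preim_mem (K : basic_domain H2) x :
  (forall s, (K : set H2) `<=` block s -> block (map gpair s) x) ->
  (bd_preim K : set H1) x.
Proof.
move=> hx y; apply: bd_mem_blocks => s Ks.
suff : ideal_interior (f @^-1` block s) x by apply.
by rewrite interior_preim_block; apply: hx.
Qed.

(** The hypothesis on [x] says that [x] lies in the image of the join of the
    members of [l]. In the induction step the first member [K] is exchanged
    for [r], which replaces [x] by [residue r x]; at the end [r] occurs twice,
    and a block is insensitive to repetition. *)
Lemma interior_preim_join (I : eqType) (F : I -> basic_domain H2) (l : seq I)
    (r : seq (H1 * H1)) (x : H1) :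
  (forall i, i \in l -> bd_preim (F i) `<=` block r) ->
  (forall t, (forall i, i \in l -> (F i : set H2) `<=` block t) ->
    block (map gpair t) x) ->
  block r x.
Proof.
elim: l x => [|i l IH] x lr hx.
  have : block (map gpair [::]) x by apply: hx.
  by rewrite block_nil => ->; exact: ideal_mem1 (block_ideal r).
suff : block r (residue r x).
  move/block_cat; rewrite (@eq_mem_block _ _ _ r) // => p.
  by rewrite mem_cat orbb.
apply: IH => [j jl|t lt]; first by apply: lr; rewrite inE jl orbT.
apply/block_cat; rewrite (@eq_mem_block _ _ _ (r ++ map gpair t)); last first.
  by move=> p; rewrite !mem_cat orbC.
apply/block_cat; apply: (lr i (mem_head _ _)).
apply: bd_preim_mem => s Fis; apply/block_cat; rewrite -map_cat.
apply: hx => j; rewrite inE => /orP[/eqP ->|jl].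
  by apply: subset_trans Fis _; apply: block_catl.
by apply: subset_trans (lt j jl) _; apply: block_catr.
Qed.

Lemma bd_preim_sup (F : set (basic_domain H2)) : finite_set F ->
  bd_preim (bd_sup F) = bd_sup (bd_preim @` F).
Proof.
move=> /(@finite_seqP {classic (basic_domain H2)})[l Fl].
apply: bd_eqP; apply/seteqP; split; last first.
  apply: bd_sup_le => _ [K FK <-].
  by apply: bd_preim_mono; apply: bd_le_sup.
move=> x Fx; apply: bd_mem_blocks => r Fr.
apply: (@interior_preim_join {classic (basic_domain H2)} id l).
  move=> K lK; apply: subset_trans Fr; apply: bd_le_sup.
  by exists K => //; rewrite Fl.
move=> t lt; rewrite -interior_preim_block => y.
apply: (@bd_sup_le _ _ F (BasicDomain (block_basic t))) (Fx y) => K.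
by rewrite Fl; apply: lt.
Qed.

Lemma bd_preim_inf (F : set (basic_domain H2)) :
  bd_preim (bd_inf F) = bd_inf (bd_preim @` F).
Proof.
apply: bd_eqP; apply/seteqP; split=> [x Fx _ [K FK <-] y|x Fx y K FK].
  exact: Fx.
suff Kx : (bd_preim K : set H1) x by exact: Kx.
by apply: Fx; exists K.
Qed.

Lemma bd_preim_opn b : bd_preim (bd_opn b) = bd_opn (g b).
Proof.
by apply: bd_eqP; rewrite /= !opn_block1 interior_preim_block /= /gpair /= g1.
Qed.

Lemma preim_cld b : f @^-1` cld b = cld (g b).
Proof. by apply/seteqP; split=> x; rewrite /cld /= gf. Qed.

End Preimage.

Theorem corollary7p6 (d1 d2 : Order.disp_t)
    (H1 : heytingSemilatticeType d1) (H2 : heytingSemilatticeType d2)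
    (f : H1 -> H2) (fstar : H2 -> H1)
    (f_cont : hcontinuous f) (f_adj : left_adjoint fstar f) :
  exists fl : basic_domain H2 -> basic_domain H1,
    [/\ forall K : basic_domain H2, largest_basic_domain_in (f @^-1` K) (fl K),
        coframe_hom fl
      & forall b : H2,
          fl (bd_opn b) = bd_opn (fstar b) /\
          exists2 N : basic_domain H1, N = f @^-1` (cld b) :> set H1 &
            unique (bd_complement N) (bd_opn (fstar b))].
Proof.
have [g gf [g1 gI]] := f_cont.
(* Left adjoints are unique, so the meet-preserving one is [fstar]. *)
have gE : fstar = g.
  by apply: funext => b; apply/eqP; rewrite eq_le f_adj -gf lexx gf -f_adj lexx.
subst g; exists (bd_preim f_adj g1 gI); split.
- exact: bd_preim_largest.
- by split=> [F|F finF]; [apply: bd_preim_inf|apply: bd_preim_sup].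
- move=> b; split; first exact: bd_preim_opn.
  exists (bd_cld (fstar b)); first by rewrite (preim_cld f_adj).
  exact: bd_opn_complement.
Qed.
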